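(* Let $\alpha=\Omega(1)$. For any two positive integers $\lambda$ and $n$ such that $n\ge\lambda+1$, there exists an $n$-node graph $G$ whose edge connectivity is $\lambda$ such that $\Omega\left(\frac{n}{\lambda\log\alpha}\right)$ is a lower bound on the number of CONGEST rounds needed for computing $\alpha$-approximate weighted all pairs shortest paths (APSP) with probability at least $1/2$ on $G$, where all the edge weights are integers in $[n^c]$ for some constant $c>0$.
   Context: CONGEST model: the network is an undirected graph $G=(V,E)$ with $n=|V|$; computation proceeds in synchronous rounds; in each round each node can send one $O(\log n)$-bit message to each of its neighbors; local computation is free. Algorithms may be randomized. Each edge weight is initially known only to the edge's endpoints; the lower bound is for the worst case over the weight assignments. $[x]$ denotes $\{1,2,\dots,\lfloor x\rfloor\}$. Weighted APSP: each node must learn (an estimate of) its weighted distance to every other node. A distance estimate $\tilde d$ is an $\alpha$-approximation of the weighted shortest-path distance $d$ if $d(u,v)\le\tilde d(u,v)\le\alpha\,d(u,v)$ for all nodes $u,v$. Edge connectivity: the number of edges in a minimum edge cut of the (unweighted) graph.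
   Formalization: α is bounded below by a constant above 1 and above by n^a, with a any fixed real and c depending on a (for larger α a constant output works in 0 rounds); the round bound is claimed only for n ≥ 3, since for n = 2 both nodes know the only weight. *)

(* Defs.v *)
From HB Require Import structures.
From mathcomp Require Import all_boot all_order all_algebra.
From mathcomp Require Import all_classical all_reals all_analysis.

Set Implicit Arguments.
Unset Strict Implicit.
Unset Printing Implicit Defensive.

Import Order.TTheory GRing.Theory Num.Theory.

Local Open Scope classical_set_scope.
Local Open Scope ring_scope.

Record sgraph (n : nat) := SGraph {
  adj :> rel 'I_n;
  adj_sym : symmetric adj;
  adj_irr : irreflexive adj }.

(* A crossing edge is listed once, oriented from its endpoint in S to its
   endpoint outside S. *)
Definition edge_cut (n : nat) (G : sgraph n) (S : {set 'I_n}) :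
    {set 'I_n * 'I_n} :=
  [set p | [&& p.1 \in S, p.2 \notin S & G p.1 p.2]]%SET.

(* As a relation, because the minimum is over an empty family when n <= 1. *)
Definition is_edge_connectivity (n : nat) (G : sgraph n) (k : nat) : Prop :=
  (exists S : {set 'I_n},
     [/\ S != finset.set0, S != finset.setT & #|edge_cut G S| = k]) /\
  (forall S : {set 'I_n},
     S != finset.set0 -> S != finset.setT -> (k <= #|edge_cut G S|)%N).

(* Only the values of w on edges are meaningful. *)
Definition weight_assignment (n : nat) := 'I_n -> 'I_n -> nat.

(* Every edge has one weight, in {1, ..., floor M}. *)
Definition weights_in (R : realType) (n : nat) (G : sgraph n) (M : R)
    (w : weight_assignment n) : Prop :=
  forall u v, G u v ->
    [/\ w u v = w v u, (0 < w u v)%N & (w u v)%:R <= M].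

Definition walk_weight (n : nat) (w : weight_assignment n) (u : 'I_n)
    (p : seq 'I_n) : nat :=
  sumn (pairmap w u p).

(* +oo when v is not reachable from u. *)
Definition wdist (R : realType) (n : nat) (G : sgraph n)
    (w : weight_assignment n) (u v : 'I_n) : \bar R :=
  ereal_inf [set (walk_weight w u p)%:R%:E |
             p in [set p : seq 'I_n | path G u p /\ last u p = v]].

(* est u v is the estimate of the distance from u to v held by node u. *)
Definition approx_apsp (R : realType) (n : nat) (G : sgraph n)
    (w : weight_assignment n) (alpha : R) (est : 'I_n -> 'I_n -> R) : Prop :=
  forall u v, (wdist R G w u v <= (est u v)%:E <= alpha%:E * wdist R G w u v)%E.

(* Messages are bit strings of length at most B; the empty string stands for
   silence. *)
Definition message (B : nat) := B.-bseq bool.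

(* A distributed algorithm on the vertex set 'I_n, with an unrestricted local
   state. [init v s x] is the initial state of node v with random seed s and
   incident edge weights x; [send q u] is the message a node in state q sends to
   its neighbour u; [recv q m] is the next state, m u being the message received
   from u; [output q u] is the resulting distance estimate to node u. *)
Record algorithm (R : realType) (n B : nat) (Seed : Type) := Algorithm {
  state : Type;
  init : 'I_n -> Seed -> ('I_n -> nat) -> state;
  send : state -> 'I_n -> message B;
  recv : state -> ('I_n -> message B) -> state;
  output : state -> 'I_n -> R }.

(* The part of the input known to v: weights of non-incident pairs are masked. *)
Definition incident_weights (n : nat) (G : sgraph n) (w : weight_assignment n)
    (v u : 'I_n) : nat :=
  if G v u then w v u else 0%N.

Fixpoint run (R : realType) (n B : nat) (Seed : Type) (G : sgraph n)
    (A : algorithm R n B Seed) (seed : 'I_n -> Seed) (w : weight_assignment n)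
    (t : nat) : 'I_n -> state A :=
  match t with
  | 0 => fun v => init A v (seed v) (incident_weights G w v)
  | t'.+1 => fun v =>
      recv (run G A seed w t' v)
        (fun u => if G u v then send (run G A seed w t' u) v else [bseq])
  end.

Definition estimates (R : realType) (n B : nat) (Seed : Type) (G : sgraph n)
    (A : algorithm R n B Seed) (seed : 'I_n -> Seed) (w : weight_assignment n)
    (T : nat) (u v : 'I_n) : R :=
  output (run G A seed w T u) v.

Definition independent_seeds (R : realType) (n : nat)
    (d : measure_display) (Omega : measurableType d) (P : probability Omega R)
    (d' : measure_display) (Seed : measurableType d')
    (seed : 'I_n -> Omega -> Seed) : Prop :=
  (forall v, measurable_fun [set: Omega] (seed v)) /\
  (forall E : 'I_n -> set Seed, (forall v, measurable (E v)) ->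
     P (\bigcap_(v in [set: 'I_n]) (seed v @^-1` E v)) =
     (\prod_(v < n) P (seed v @^-1` E v))%E).

(* Some T-round randomized algorithm with B-bit messages and private randomness
   succeeds with probability at least p, for every weight assignment of G with
   weights in {1, ..., floor M}. The algorithm is chosen after G, so the nodes
   may know the topology and everything else except the weights. *)
Definition apsp_solvable (R : realType) (n : nat) (G : sgraph n)
    (B : nat) (M alpha p : R) (T : nat) : Prop :=
  exists (d : measure_display) (Omega : measurableType d)
         (P : probability Omega R)
         (d' : measure_display) (Seed : measurableType d')
         (seed : 'I_n -> Omega -> Seed) (A : algorithm R n B Seed),
    independent_seeds P seed /\
    forall w : weight_assignment n, weights_in G M w ->
      let success := [set omega |
        approx_apsp G w alpha
          (estimates G A (fun v => seed v omega) w T)] in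
      measurable success /\ (p%:E <= P success)%E.

(* Main.v *)
(* The graph is the lambda-th power of a path on n vertices. Any lambda + 1
   consecutive vertices form a clique, and some such clique is split by a given
   cut, so the edge connectivity is lambda. Information travels at most lambda
   positions per round; hence, if T is too small compared with n / lambda, the
   last vertex knows nothing about the weight W shared by the edges at vertex 0.
   Its distance to vertex 0 lies in [W, W + n], and three well separated values
   of W admit pairwise disjoint sets of valid estimates. The three success events
   are then disjoint, so they cannot all have probability at least 1/2. *)
Require Import Defs.
From HB Require Import structures.
From mathcomp Require Import all_boot all_order all_algebra.
From mathcomp Require Import all_classical all_reals all_analysis.
From mathcomp Require Import zify lra.

Set Implicit Arguments.
Unset Strict Implicit.
Unset Printing Implicit Defensive.

Import Order.TTheory GRing.Theory Num.Theory.
Local Open Scope ring_scope.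

Section PathPower.
Local Open Scope nat_scope.

(** * Powers of a path and their edge connectivity *)

Definition path_power_adj (lambda n : nat) : rel 'I_n :=
  fun u v => [&& u != v, u <= v + lambda & v <= u + lambda].

Lemma path_power_sym (lambda n : nat) : symmetric (@path_power_adj lambda n).
Proof. by move=> u v; rewrite /path_power_adj eq_sym [X in _ && X]andbC. Qed.

Lemma path_power_irr (lambda n : nat) : irreflexive (@path_power_adj lambda n).
Proof. by move=> u; rewrite /path_power_adj eqxx. Qed.

Definition path_power (lambda n : nat) : sgraph n :=
  SGraph (@path_power_sym lambda n) (@path_power_irr lambda n).

(** If the cut splits the clique into parts of sizes [a] and [b], both positive, it contains all
    [a * b] edges between them, and [a * b >= a + b - 1]. *)
Lemma clique_edge_cut (n : nat) (G : sgraph n) (K S : {set 'I_n}) :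
  {in K &, forall u v, u != v -> G u v} ->
  (K :&: S != finset.set0)%SET -> (K :\: S != finset.set0)%SET ->
  #|K|.-1 <= #|edge_cut G S|.
Proof.
move=> clK; rewrite -!card_gt0 => I0 D0.
have sub : (finset.setX (K :&: S) (K :\: S) \subset edge_cut G S)%SET.
  apply/fintype.subsetP => -[u v]; rewrite !inE /=.
  move=> /andP[/andP[uK uS] /andP[vS vK]]; rewrite uS vS /=.
  by apply: clK => //; apply: contraNneq vS => <-.
apply: leq_trans (subset_leq_card sub).
by rewrite cardsX -(cardsID S K); nia.
Qed.

Lemma alternation_consecutive (P : pred nat) (i j : nat) :
  i < j -> P i != P j -> exists2 k, i <= k < j & P k != P k.+1.
Proof.
elim: j => // j IH; rewrite ltnS leq_eqVlt => /predU1P[->|ij] Pij.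
  by exists j; rewrite ?leqnn.
have [Pj|Pj] := eqVneq (P j) (P j.+1); last by exists j => //; rewrite ltnW/=.
by rewrite -Pj in Pij; have [k kij Pk] := IH ij Pij; exists k => //; lia.
Qed.

Lemma path_power_edge_cut (lambda n : nat) (S : {set 'I_n.+1}) :
  0 < lambda -> lambda <= n ->
  S != finset.set0 -> S != finset.setT ->
  lambda <= #|edge_cut (path_power lambda n.+1) S|.
Proof.
move=> l0 ln /finset.set0Pn[x xS] /eqP ST.
have [y yS] : exists y, y \notin S.
  apply/existsP; apply: contra_notT ST => /existsPn h.
  by apply/setP => z; rewrite inE; have := h z; rewrite negbK.
pose P k := inord k \in S.
have Pxy : P x != P y by rewrite /P !inord_val xS (negbTE yS).
have [k kn Pk] : exists2 k, k < n & P k != P k.+1.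
  have [xn yn] := (ltn_ord x, ltn_ord y).
  case: (ltngtP x y) => [xy|xy|/val_inj xy].
  - by have [k ? ?] := alternation_consecutive xy Pxy; exists k => //; lia.
  - rewrite eq_sym in Pxy.
    by have [k ? ?] := alternation_consecutive xy Pxy; exists k => //; lia.
  - by rewrite xy eqxx in Pxy.
(* The window of [lambda + 1] vertices starting at [m] contains both [k] and [k.+1]; the minimum
   keeps its right end at most [n]. *)
pose m := minn k (n - lambda).
pose K := [set i : 'I_n.+1 | m <= i <= m + lambda]%SET.
have kK : inord k \in K by rewrite inE inordK /m; lia.
have k1K : inord k.+1 \in K by rewrite inE inordK /m; lia.
have clK : {in K &, forall u v, u != v -> path_power lambda n.+1 u v}.
  by move=> u v; rewrite !inE /= /path_power_adj => uK vK ->; lia.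
have cardK : lambda < #|K|.
  have f_inj : injective (fun i : 'I_lambda.+1 => inord (m + i) : 'I_n.+1).
    move=> i j; have [il jl] := (ltn_ord i, ltn_ord j).
    move=> /(congr1 val); rewrite /= !inordK /m; [|lia|lia].
    by move=> /addnI; exact: val_inj.
  rewrite -[X in X <= _]card_ord -(card_imset _ f_inj); apply: subset_leq_card.
  apply/fintype.subsetP => _ /imsetP[i _ ->]; have il := ltn_ord i.
  by rewrite inE inordK /m; lia.
apply: (@leq_trans #|K|.-1); first by lia.
apply: clique_edge_cut => //.
- apply/finset.set0Pn; have [Pk0|Pk0] := boolP (P k).
    by exists (inord k); rewrite inE kK.
  by exists (inord k.+1); rewrite inE k1K; move: Pk Pk0; rewrite /P; do 2!case: (_ \in S).
- apply/finset.set0Pn; have [Pk0|Pk0] := boolP (P k); last first.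
    by exists (inord k); rewrite inE kK andbT.
  exists (inord k.+1); rewrite inE k1K andbT.
  by move: Pk Pk0; rewrite /P; do 2!case: (_ \in S).
Qed.

Lemma path_power_edge_connectivity (lambda n : nat) :
  0 < lambda -> lambda < n ->
  is_edge_connectivity (path_power lambda n) lambda.
Proof.
case: n => // n l0 ln; split; last first.
  by move=> S S0 ST; exact: path_power_edge_cut.
have S0 : [set ord0 : 'I_n.+1]%SET != finset.set0.
  by apply/finset.set0Pn; exists ord0; rewrite inE.
have ST : [set ord0 : 'I_n.+1]%SET != finset.setT.
  by apply/eqP => /setP/(_ ord_max); rewrite !inE -val_eqE /=; lia.
(* The end vertex 0 has the neighbours 1, ..., [lambda] only, so isolating it gives a minimum
   cut. *)
exists [set ord0]%SET; split=> //.
apply/eqP; rewrite eqn_leq path_power_edge_cut // andbT.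
have sub : edge_cut (path_power lambda n.+1) [set ord0]%SET \subset
    [set (ord0 : 'I_n.+1, inord j.+1 : 'I_n.+1) | j : 'I_lambda]%SET.
  apply/fintype.subsetP => -[u v]; rewrite !inE /= => /and3P[/eqP-> v0].
  rewrite /path_power_adj => /and3P[_ _ /=]; rewrite add0n => vl.
  have v1 : v.-1 < lambda by move: v0; rewrite -val_eqE /=; lia.
  apply/imsetP; exists (Ordinal v1) => //=; congr (_, _).
  by apply: val_inj; rewrite /= prednK ?inord_val // lt0n.
by rewrite (leq_trans (subset_leq_card sub)) // (leq_trans (leq_imset_card _ _)) ?card_ord.
Qed.

(** * Hard weights and the distances they induce *)

(* The edge between the two end vertices, present when lambda = n, keeps the
   weight M: the last vertex must not see W even if it is adjacent to 0. *)
Definition end_weight (n M W : nat) : weight_assignment n.+1 :=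
  fun u v => if (u == ord0) || (v == ord0) then
               if (u == ord_max) || (v == ord_max) then M else W
             else 1.

(** The step that first enters vertex 0 already costs [W] or [M]. *)
Lemma walk_weight_end_ge (n M W : nat) (u : 'I_n.+1) (p : seq 'I_n.+1) :
  W <= M -> u != ord0 -> last u p = ord0 -> W <= walk_weight (end_weight M W) u p.
Proof.
move=> WM; elim: p u => [|x p IH] u u0 /=; first by move=> u0'; rewrite u0' in u0.
have [-> _|x0 lx] := eqVneq x ord0; last exact: leq_trans (IH _ x0 lx) (leq_addl _ _).
apply: leq_trans (leq_addr _ _).
by rewrite /end_weight eqxx orbT; case: ifP.
Qed.

(** Descend one vertex at a time along unit edges, then pay for the edge from 1 to 0. With at least
    three vertices, 1 is not the last vertex, so that edge weighs [W] and not [M]. *)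
Lemma walk_weight_end_le (lambda n M W : nat) (u : 'I_n.+3) :
  0 < lambda -> 0 < u ->
  exists p, [/\ path (path_power lambda n.+3) u p, last u p = ord0 &
                walk_weight (end_weight M W) u p <= W + u].
Proof.
move=> l0; case: u => [[//|i] iu] _; elim: i iu => [|i IH] iu.
  exists [:: ord0]; split=> //=; first by rewrite andbT /path_power_adj /=; lia.
  by rewrite /walk_weight /= addn0 leq_addr.
have iu' : i.+1 < n.+3 by exact: ltnW.
have [p [pp lp wp]] := IH iu'.
exists (Ordinal iu' :: p); split=> //=.
  by rewrite pp andbT /path_power_adj -val_eqE /=; lia.
move: wp; rewrite /walk_weight /= [end_weight _ _ (Ordinal iu) _]/end_weight.
by rewrite -!val_eqE /=; lia.
Qed.

End PathPower.

Lemma wdist_end_ge (R : realType) (lambda n M W : nat) :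
  (W <= M)%N ->
  (W%:R%:E <= wdist R (path_power lambda n.+2) (end_weight M W) ord_max ord0)%E.
Proof.
move=> WM; apply: le_ereal_inf_tmp => _ [p [_ lp] <-].
by rewrite lee_fin ler_nat; exact: walk_weight_end_ge.
Qed.

Lemma wdist_end_le (R : realType) (lambda n M W : nat) :
  (0 < lambda)%N ->
  (wdist R (path_power lambda n.+3) (end_weight M W) ord_max ord0
    <= (W + n.+3)%:R%:E)%E.
Proof.
move=> l0; have [|p [pp lp wp]] := @walk_weight_end_le lambda n M W ord_max l0 => //.
apply: (@le_trans _ _ (walk_weight (end_weight M W) ord_max p)%:R%:E).
  by apply: ereal_inf_lbound; exists p.
by rewrite lee_fin ler_nat (leq_trans wp) // leq_add2l.
Qed.

(** * Propagation of information *)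

(** Initially [W] is visible only at positions up to [lambda], and each round carries it at most
    [lambda] further. The second alternative treats zero rounds: even when adjacent to 0, the last
    vertex sees only [M] on that edge. *)
Lemma run_end_weight (R : realType) (B : nat) (Seed : Type) (lambda n M W W' : nat)
    (A : algorithm R n.+2 B Seed) (seed : 'I_n.+2 -> Seed) (t : nat) (u : 'I_n.+2) :
  (lambda * t.+1 < u)%N || (t == 0)%N && (u == ord_max) ->
  run (path_power lambda n.+2) A seed (end_weight M W) t u =
  run (path_power lambda n.+2) A seed (end_weight M W') t u.
Proof.
elim: t u => [|t IH] u /=.
  move=> hu; congr (init _ _ _ _); apply/funext => v; rewrite /incident_weights /=.
  case: ifP => // uv; rewrite /end_weight.
  have [/= ->|um] := eqVneq u ord_max; first by rewrite -!val_eqE.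
  move: hu uv; rewrite (negbTE um) /path_power_adj -!val_eqE /= muln1 orbF.
  move=> lu /and3P[_ uv _].
  have -> : (nat_of_ord u == 0)%N = false by lia.
  by have -> : (nat_of_ord v == 0)%N = false by lia.
rewrite orbF => hu; congr (recv _ _).
  by apply: IH; apply/orP; left; apply: leq_ltn_trans hu; rewrite leq_mul2l leqnSn orbT.
apply/funext => v; case: ifP => // /and3P[_ _ uv]; congr (send _ _).
by apply: IH; apply/orP; left; move: hu uv; rewrite (mulnS _ t.+1); lia.
Qed.

Lemma end_weights_in (R : realType) (lambda n M W : nat) (x : R) :
  (0 < W)%N -> (W <= M)%N -> M%:R <= x ->
  weights_in (path_power lambda n.+1) x (end_weight M W).
Proof.
move=> W0 WM Mx u v _; have W1 : 1 <= W%:R :> R by rewrite ler1n.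
have WMR : W%:R <= M%:R :> R by rewrite ler_nat.
rewrite /end_weight orbC [X in if X then M else _]orbC.
by split; do ?[case: ifP => _] => //; [exact: leq_trans WM| |]; lra.
Qed.

(** * Incompatible success events and the round bound *)

(** Two disjoint events may each have probability exactly 1/2; a third brings the total to 3/2. *)
Lemma three_disjoint_half (R : realType) (d : measure_display)
    (Omega : measurableType d) (P : probability Omega R) (F : nat -> set Omega) :
  (forall k, (k < 3)%N -> measurable (F k) /\ ((1 / 2)%:E <= P (F k))%E) ->
  (forall i j omega, (i < j < 3)%N -> F i omega -> ~ F j omega) -> False.
Proof.
move=> hF disj.
have [[[m0 p0] [m1 p1]] [m2 p2]] := (hF 0%N isT, hF 1%N isT, hF 2%N isT).
have d01 : (F 0%N `&` F 1%N = set0)%classic.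
  by rewrite -subset0 => o [F0 F1]; exact: (disj 0%N 1%N o).
have d012 : ((F 0%N `|` F 1%N) `&` F 2%N = set0)%classic.
  by rewrite -subset0 => o [[F0|F1] F2];
    [exact: (disj 0%N 2%N o)|exact: (disj 1%N 2%N o)].
have m01 := measurableU _ _ m0 m1.
have := probability_le1 P (measurableU _ _ m01 m2).
rewrite measureU // measureU //; apply/negP; rewrite -ltNge.
apply: lt_le_trans (leeD (leeD p0 p1) p2).
by rewrite -!EFinD lte_fin; lra.
Qed.

Lemma path_power_apsp_round (R : realType) (lambda n B A T : nat) (x alpha : R) :
  (0 < lambda)%N -> 0 <= alpha -> alpha <= n.+3%:R ^+ A ->
  n.+3%:R ^+ (2 * A + 7) <= x ->
  apsp_solvable (path_power lambda n.+3) B x alpha (1 / 2) T ->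
  (0 < T)%N && (n.+2 <= lambda * T.+1)%N.
Proof.
move=> l0 alpha0 alphaA Mx [d [ Omega [P [d' [Seed [seed [Alg [_ H]]]]]]]].
apply: contraT => hT; exfalso.
(* The ratio [n.+3 ^ (A + 3)] of consecutive values beats both [alpha] and the additive error
   [n.+3 <= W k]. The largest value used, [W 2], is [n.+3 ^ (2 * A + 7)], whence the exponent in the
   bound on [x]. *)
pose W k := (n.+3 ^ (1 + k * (A + 3)))%N.
have W_mono i j : (i <= j)%N -> (W i <= W j)%N.
  by move=> ij; rewrite leq_exp2l // leq_add2l leq_mul2r ij orbT.
have W_gap i : alpha * (W i + n.+3)%:R < (W i.+1)%:R.
  apply: (@le_lt_trans _ _ (n.+3 ^ (A + (2 + i * (A + 3))))%:R); last first.
    by rewrite ltr_nat ltn_exp2l //; lia.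
  rewrite expnD natrM natrX ler_pM // ler_nat.
  have nW : (n.+3 <= W i)%N by rewrite -[X in (X <= _)%N]expn1 leq_exp2l.
  by rewrite addSn expnS -/(W i); nia.
pose w k : weight_assignment n.+3 := end_weight (W 2%N) (W k).
pose F k : set Omega := [set omega | approx_apsp (path_power lambda n.+3) (w k) alpha
  (estimates (path_power lambda n.+3) Alg (fun v => seed v omega) (w k) T)]%classic.
pose e omega := estimates (path_power lambda n.+3) Alg
  (fun v => seed v omega) (w 0%N) T ord_max ord0.
have eE k omega : estimates (path_power lambda n.+3) Alg
    (fun v => seed v omega) (w k) T ord_max ord0 = e omega.
  rewrite /e /estimates (@run_end_weight _ _ _ _ _ _ _ (W 0%N)) //=.
  by move: hT; rewrite negb_and -leqNgt leqn0 -ltnNge -val_eqE /= eqxx andbT orbC.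
(* The same number [e omega] would have to lie in disjoint intervals. *)
have Fe k omega : (k < 3)%N -> F k omega -> (W k)%:R <= e omega < (W k.+1)%:R.
  move=> k3 /(_ ord_max ord0); rewrite eE => /andP[lo hi].
  apply/andP; split.
    by rewrite -lee_fin; apply: le_trans lo; apply: wdist_end_ge; exact: W_mono.
  apply: le_lt_trans (W_gap k); rewrite -lee_fin EFinM.
  apply: (le_trans hi); apply: lee_wpmul2l; first by rewrite lee_fin.
  exact: wdist_end_le.
apply: (@three_disjoint_half R d Omega P F) => [k k3|i j omega /andP[ij j3]].
  apply: H; apply: end_weights_in.
  - by rewrite expn_gt0.
  - exact: W_mono.
  - by apply: le_trans Mx; rewrite natrX ler_weXn2l ?ler1n //; lia.
move=> /(Fe _ _ (ltn_trans ij j3))/andP[_ ei] /(Fe _ _ j3)/andP[ej _].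
have := le_lt_trans ej ei.
by rewrite ltr_nat ltnNge W_mono.
Qed.

Theorem theorem9 (R : realType) (b : nat) (alpha0 : R) (halpha0 : 1 < alpha0) :
  exists kappa : R, 0 < kappa /\
  forall a : R, exists c : R, 0 < c /\
  forall (lambda n : nat) (alpha : R),
    (0 < lambda)%N -> (lambda + 1 <= n)%N ->
    alpha0 <= alpha -> alpha <= n%:R `^ a ->
    exists G : sgraph n,
      is_edge_connectivity G lambda /\
      ((2 < n)%N ->
       forall T : nat,
         apsp_solvable G (b * up_log 2 n) (n%:R `^ c) alpha (1 / 2) T ->
         kappa * (n%:R / (lambda%:R * ln alpha)) <= T%:R).
Proof.
have ln0 : 0 < ln alpha0 by rewrite ln_gt0.
(* The argument gives [T] at least [n / (3 * lambda)]; the factor [ln alpha0 / ln alpha], at most 1,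
   turns this into the stated form. *)
exists (ln alpha0 / 3); split; first by rewrite divr_gt0.
move=> a; pose A := Num.bound `|a|.
exists (2 * A + 7)%:R; split; first by rewrite ltr0n addnS.
move=> lambda n alpha l0 hn al0 ala.
exists (path_power lambda n); split.
  by apply: path_power_edge_connectivity => //; rewrite -addn1.
case: n hn ala => [|[|[|n]]] // hn ala _ T sol.
have alpha_gt1 : 1 < alpha by exact: lt_le_trans al0.
have n1 : 1 <= n.+3%:R :> R by rewrite ler1n.
have /andP[T0 nT] : (0 < T)%N && (n.+2 <= lambda * T.+1)%N.
  apply: (path_power_apsp_round (A := A) _ _ _ _ sol) => //.
  - by rewrite ltW // (lt_trans _ alpha_gt1).
  - apply: (le_trans ala); rewrite -powR_mulrn ?ler0n // ler_powR //.
    by rewrite (le_trans (ler_norm a)) // ltW // archi_boundP.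
  - by rewrite powR_mulrn // ler0n.
(* As [T >= 1], [T.+1 <= 2 * T], and the missing unit is at most [lambda * T]. *)
have nTR : n.+3%:R <= 3 * lambda%:R * T%:R :> R.
  by rewrite -!natrM ler_nat; nia.
have lna : ln alpha0 <= ln alpha by rewrite ler_ln ?posrE; lra.
have lam0 : 0 < lambda%:R :> R by rewrite ltr0n.
rewrite mulrA ler_pdivrMr ?mulr_gt0 //; last exact: lt_le_trans lna.
apply: (@le_trans _ _ (ln alpha0 * (lambda%:R * T%:R))).
  by rewrite -mulrA ler_pM2l //; lra.
by rewrite mulrC [leRHS]mulrCA [leRHS]mulrA ler_wpM2l // mulr_ge0 ?ler0n.
Qed.
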